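(* For all integers $k\ge 1$ and $\ell\ge 1$, there is a finite number (up to isomorphism) of $k$-vertex-critical $(P_2+\ell P_1)$-free graphs.
   Context: All graphs are finite, simple and undirected, with at least one vertex. A graph $G$ is $H$-free if it does not contain $H$ as an induced subgraph. A graph $G$ is $k$-vertex-critical if $\chi(G)=k$ but $\chi(G-v)<k$ for every vertex $v$ of $G$, where $\chi$ is the chromatic number and $G-v$ is obtained from $G$ by deleting $v$ and its incident edges. $P_t$ is the path on $t$ vertices, and $P_2+\ell P_1$ is the disjoint union of one edge (with its two endpoints) and $\ell$ isolated vertices. Numbers of graphs are counted up to isomorphism. *)

(* Defs.v *)
From mathcomp Require Import all_boot.

Set Implicit Arguments.
Unset Strict Implicit.
Unset Printing Implicit Defensive.

(* The record admits the graph with no vertex, so that deleting a vertex is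
   always defined; nonemptiness is a separate hypothesis where it is needed. *)
Record sgraph := SGraph {
  vertex :> finType;
  edge : rel vertex;
  edge_sym : symmetric edge;
  edge_irr : irreflexive edge }.

Arguments edge {s}.

Definition iso (G H : sgraph) : Prop :=
  exists2 f : G -> H, bijective f & forall x y, edge (f x) (f y) = edge x y.

Section Induced.
Variables (G : sgraph) (A : {set G}).

Definition induced_edge : rel {x : G | x \in A} :=
  fun x y => edge (val x) (val y).

Lemma induced_sym : symmetric induced_edge.
Proof. by move=> x y; exact: edge_sym. Qed.

Lemma induced_irr : irreflexive induced_edge.
Proof. by move=> x; exact: edge_irr. Qed.

Definition induced : sgraph := SGraph induced_sym induced_irr.
End Induced.

Definition del_vertex (G : sgraph) (v : G) : sgraph := induced [set~ v].

Definition free (H G : sgraph) : Prop := ~ exists A : {set G}, iso (induced A) H.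

Definition colorable (G : sgraph) (n : nat) : bool :=
  [exists c : {ffun G -> 'I_n},
     [forall x, [forall y, edge x y ==> (c x != c y)]]].

Lemma colorable_card (G : sgraph) : exists n, colorable G n.
Proof.
exists #|G|; apply/existsP; exists [ffun x => enum_rank x].
apply/forallP => x; apply/forallP => y; apply/implyP => xy.
rewrite !ffunE (inj_eq enum_rank_inj).
by apply: contraTneq xy => ->; rewrite edge_irr.
Qed.

Definition chi (G : sgraph) : nat := ex_minn (colorable_card G).

Definition vertex_critical (k : nat) (G : sgraph) : Prop :=
  chi G = k /\ forall v : G, chi (del_vertex v) < k.

Section Path.
Variable t : nat.

Definition path_edge : rel 'I_t := fun i j => (i.+1 == j) || (j.+1 == i).

Lemma path_sym : symmetric path_edge.
Proof. by move=> i j; rewrite /path_edge orbC. Qed.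

Lemma path_irr : irreflexive path_edge.
Proof. by move=> i; rewrite /path_edge orbb gtn_eqF. Qed.

Definition path_graph : sgraph := SGraph path_sym path_irr.
End Path.

Section DisjointUnion.
Variables G H : sgraph.

Definition union_edge : rel (G + H) := fun u v =>
  match u, v with
  | inl x, inl y => edge x y
  | inr x, inr y => edge x y
  | _, _ => false
  end.

Lemma union_sym : symmetric union_edge.
Proof. by move=> [x|x] [y|y] //=; exact: edge_sym. Qed.

Lemma union_irr : irreflexive union_edge.
Proof. by move=> [x|x] /=; exact: edge_irr. Qed.

Definition disjoint_union : sgraph := SGraph union_sym union_irr.
End DisjointUnion.

Section Copies.
Variables (l : nat) (G : sgraph).

Definition copies_edge : rel ('I_l * G) := fun u v =>
  (u.1 == v.1) && edge u.2 v.2.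

Lemma copies_sym : symmetric copies_edge.
Proof. by move=> u v; rewrite /copies_edge eq_sym edge_sym. Qed.

Lemma copies_irr : irreflexive copies_edge.
Proof. by move=> u; rewrite /copies_edge edge_irr andbF. Qed.

Definition copies : sgraph := SGraph copies_sym copies_irr.
End Copies.

Definition P2_lP1 (l : nat) : sgraph :=
  disjoint_union (path_graph 2) (copies l (path_graph 1)).

(* Exactly n isomorphism classes of graphs satisfy P: the family F is a system
   of representatives of these classes. *)
Definition count_up_to_iso (P : sgraph -> Prop) (n : nat) : Prop :=
  exists F : 'I_n -> sgraph,
    [/\ forall i, P (F i),
        forall i j, iso (F i) (F j) -> i = j
      & forall G, P G -> exists i, iso G (F i)].

Definition finite_up_to_iso (P : sgraph -> Prop) : Prop :=
  exists n, count_up_to_iso P n.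

(* Main.v *)
Require Import Defs.
From mathcomp Require Import all_boot.
From mathcomp Require boolp.

(** Fix a [k]-vertex-critical [(P_2 + l P_1)]-free graph [G].  The point is that
    independent sets of [G] have bounded size; as [G] is covered by [k] of them,
    its order is then bounded, and only finitely many graphs have bounded order.

    Let [S] be a maximal independent set.  A vertex [v] outside [S] has a
    neighbour [s] in [S], so [l] non-neighbours of [v] in [S] would complete the
    edge [vs] to an induced [P_2 + l P_1]; hence [v] misses fewer than [l]
    vertices of [S] ([card_nonneighbours_lt]).  Now pick [s] in [S] and colour
    [G - s] with [k - 1] colours.  A colour used on at least [l] vertices of
    [S - s] cannot be used outside [S], so it is not used next to [s], and giving
    it to [s] would colour [G] with [k - 1] colours.  Therefore each of the
    [k - 1] colours is used at most [l - 1] times on [S - s], and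
    [|S| <= (k - 1)(l - 1) + 1] ([card_maximal_independent]). *)

Set Implicit Arguments.
Unset Strict Implicit.
Unset Printing Implicit Defensive.

(** * Graph isomorphism *)

Lemma iso_sym G H : iso G H -> iso H G.
Proof.
case=> f [g fK gK] f_edge; exists g; first by exists f.
by move=> x y; rewrite -f_edge !gK.
Qed.

Lemma iso_trans G H K : iso G H -> iso H K -> iso G K.
Proof.
case=> f f_bij f_edge [g g_bij g_edge].
exists (g \o f); first exact: bij_comp.
by move=> x y; rewrite /= g_edge f_edge.
Qed.

Lemma embedding_not_free (G H : sgraph) (f : H -> G) :
  injective f -> (forall x y, edge (f x) (f y) = edge x y) -> ~ free H G.
Proof.
move=> f_inj f_edge; apply; exists (f @: setT); apply: iso_sym.
have fP x : f x \in f @: setT by rewrite imset_f.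
exists (fun x => exist _ (f x) (fP x)); last exact: f_edge.
apply: inj_card_bij => [x y [/f_inj]//|].
by rewrite card_sig /= card_imset // cardsT.
Qed.

(** * Finiteness of the graphs of bounded order *)

(** A graph satisfying [P] is determined up to isomorphism by the set of those
    [t] for which it is isomorphic to [D t], and there are finitely many such
    sets.  Choosing for each set that occurs a graph satisfying [P] yields the
    representatives. *)
Lemma finite_up_to_iso_codes (P : sgraph -> Prop) (T : finType)
    (D : T -> sgraph) :
  (forall G, P G -> exists t, iso G (D t)) -> finite_up_to_iso P.
Proof.
move=> coded.
pose sig G := [set t | boolp.asbool (iso G (D t))].
have sigP G t : reflect (iso G (D t)) (t \in sig G).
  by rewrite inE; exact: boolp.asboolP.
pose A := [set X | boolp.asbool (exists2 G, P G & sig G = X)].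
have [F F_P] : {F : 'I_#|A| -> sgraph &
    forall i, P (F i) /\ sig (F i) = enum_val i}.
  apply: (boolp.choice (P := fun i G => P G /\ sig G = enum_val i)) => i.
  have := enum_valP i.
  by rewrite inE => /boolp.asboolP[G PG sigG]; exists G.
exists #|A|, F; split=> [i|i j Fij|G PG]; first by case: (F_P i).
- apply: enum_val_inj; rewrite -(proj2 (F_P i)) -(proj2 (F_P j)).
  apply/setP=> t; apply/sigP/sigP; apply: iso_trans => //.
  exact: iso_sym.
- have AG : sig G \in A by rewrite inE; apply/boolp.asboolP; exists G.
  have [t Gt] := coded G PG; exists (enum_rank_in AG (sig G)).
  apply: (iso_trans Gt); apply: iso_sym; apply/sigP.
  by rewrite (proj2 (F_P _)) enum_rankK_in //; apply/sigP.
Qed.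

Section GraphOfPairs.
Variables (n : nat) (E : {set 'I_n * 'I_n}).

(** Symmetrised and stripped of loops, so that every set of pairs is a code. *)
Definition pairs_edge : rel 'I_n := fun i j =>
  (i != j) && (((i, j) \in E) || ((j, i) \in E)).

Lemma pairs_sym : symmetric pairs_edge.
Proof. by move=> i j; rewrite /pairs_edge eq_sym orbC. Qed.

Lemma pairs_irr : irreflexive pairs_edge.
Proof. by move=> i; rewrite /pairs_edge eqxx. Qed.

Definition pairs_graph : sgraph := SGraph pairs_sym pairs_irr.
End GraphOfPairs.

Lemma iso_pairs_graph (G : sgraph) :
  iso G (pairs_graph [set p : 'I_#|G| * 'I_#|G| |
                       edge (enum_val p.1) (enum_val p.2)]).
Proof.
exists enum_rank; first exact: enum_rank_bij.
move=> x y; rewrite [LHS]/edge /= /pairs_edge !inE /= !enum_rankK.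
rewrite (inj_eq enum_rank_inj) [edge y x]edge_sym orbb.
by case: eqP => // ->; rewrite edge_irr.
Qed.

Lemma finite_up_to_iso_bounded (P : sgraph -> Prop) (N : nat) :
  (forall G, P G -> #|G| <= N) -> finite_up_to_iso P.
Proof.
move=> bound.
apply: (@finite_up_to_iso_codes P {n : 'I_N.+1 & {set 'I_n * 'I_n}}
          (fun t => pairs_graph (tagged t))) => G PG.
have leN : #|G| < N.+1 by rewrite ltnS bound.
by exists (Tagged (fun n : 'I_N.+1 => {set 'I_n * 'I_n})
             (i := Ordinal leN) [set p | edge (enum_val p.1) (enum_val p.2)]);
  exact: iso_pairs_graph.
Qed.

(** * Colourings *)

(** Colours are taken in [nat] rather than in ['I_n]: a colouring of a part of
    [G] then extends to a function on [G] even if there is no colour at all. *)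
Definition proper_on (G : sgraph) (A : {set G}) (n : nat) (c : G -> nat) :=
  {in A, forall x, c x < n} /\ {in A &, forall x y, edge x y -> c x != c y}.

Lemma colorable_proper (G : sgraph) (n : nat) :
  colorable G n <-> exists c, proper_on [set: G] n c.
Proof.
split=> [/existsP[c /forallP cP]|[c [c_lt c_edge]]].
  exists (fun x => val (c x)); split=> [x _ /=//|x y _ _ xy].
  by move/forallP/(_ y)/implyP/(_ xy): (cP x).
have lt x : c x < n by rewrite c_lt ?inE.
apply/existsP; exists [ffun x => Ordinal (lt x)].
apply/forallP=> x; apply/forallP=> y; apply/implyP=> xy.
by rewrite !ffunE -val_eqE /= c_edge ?inE.
Qed.

Lemma induced_colorable_proper (G : sgraph) (A : {set G}) (n : nat) :
  colorable (induced A) n -> exists c, proper_on A n c.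
Proof.
case/colorable_proper=> c [c_lt c_edge].
exists (fun x => oapp c 0 (insub x)); split=> [x xA|x y xA yA xy].
  by rewrite insubT /= c_lt ?inE.
by rewrite !insubT /= c_edge ?inE.
Qed.

Lemma colorableE (G : sgraph) (n : nat) : colorable G n = (chi G <= n).
Proof.
rewrite /chi; case: ex_minnP => m Gm min_m; apply/idP/idP => [/min_m//|mn].
have /colorable_proper[c [c_lt c_edge]] := Gm.
apply/colorable_proper; exists c; split=> // x xA.
exact: leq_trans (c_lt x xA) mn.
Qed.

Lemma card_le_classes (T : finType) (A : {set T}) (c : T -> nat) (n m : nat) :
  {in A, forall x, c x < n} ->
  (forall i, i < n -> #|[set x in A | c x == i]| <= m) -> #|A| <= n * m.
Proof.
elim: n A => [|n IHn] A c_lt classes.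
  rewrite leqn0 cards_eq0; apply/eqP/setP=> x; rewrite inE.
  by apply/negP => /c_lt.
rewrite mulSn -(cardsID [set x | c x == n] A) leq_add //.
  apply: leq_trans (classes n (ltnSn n)).
  by apply/subset_leq_card/subsetP=> x; rewrite !inE.
apply: IHn => [x|i lt_in].
  by rewrite !inE => /andP[ne_n /c_lt]; rewrite ltnS leq_eqVlt (negPf ne_n).
apply: leq_trans (classes i (ltnW lt_in)).
apply/subset_leq_card/subsetP=> x; rewrite !inE.
by case/andP=> /andP[_ ->] ->.
Qed.

(** * Independent sets in critical graphs without an induced [P_2 + l P_1] *)

Definition independent (G : sgraph) (S : {set G}) : bool :=
  [forall x in S, [forall y in S, ~~ edge x y]].

Lemma independentP (G : sgraph) (S : {set G}) :
  reflect {in S &, forall x y, edge x y = false} (independent S).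
Proof.
apply: (iffP forall_inP) => [h x y xS yS|h x xS].
  by move/forall_inP/(_ y yS)/negPf: (h x xS).
by apply/forall_inP=> y yS; rewrite h.
Qed.

Lemma not_free_P2_lP1 (G : sgraph) (l : nat) (u v : G) (B : {set G}) :
  edge u v -> independent B -> l <= #|B| ->
  {in B, forall x, ~~ edge u x} -> {in B, forall x, ~~ edge v x} ->
  ~ free (P2_lP1 l) G.
Proof.
move=> uv /independentP indB lB uB vB.
pose b (j : 'I_l) := enum_val (widen_ord lB j) : G.
have bB j : b j \in B by exact: enum_valP.
pose e (i : 'I_2) := if i == ord0 then u else v.
have eb i j : edge (e i) (b j) = false.
  by apply/negbTE; rewrite /e; case: ifP => _; [apply: uB | apply: vB].
(* A vertex of [B] has no neighbour among [u] and [v], so it is neither. *)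
have e_neq_b i j : e i <> b j.
  rewrite /e => eib; have := uB _ (bB j); have := vB _ (bB j).
  case: ifP eib => _ <-; last by rewrite uv.
  by rewrite [edge v u]edge_sym uv.
have u_neq_v : (u == v) = false.
  by apply/eqP=> eq_uv; rewrite eq_uv edge_irr in uv.
pose f (x : P2_lP1 l) : G :=
  match x with inl i => e i | inr j => b j.1 end.
apply: (@embedding_not_free _ _ f) => [[i|[i i0]] [j|[j j0]] /=|].
- rewrite /e; case: i j => [[|[|//]] i_lt] [[|[|//]] j_lt] //= eq_e;
    do ?[by congr inl; apply: val_inj];
    by move/eqP: eq_e; rewrite ?[v == u]eq_sym u_neq_v.
- by move/e_neq_b.
- by move/esym/e_neq_b.
- move/enum_val_inj/(congr1 val) => /= /val_inj ->.
  by rewrite (ord1 i0) (ord1 j0).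
- case=> [i|[i i0]] [j|[j j0]] /=.
  + rewrite /e; case: i j => [[|[|//]] i_lt] [[|[|//]] j_lt];
      by rewrite /path_edge /= ?edge_irr ?uv // edge_sym uv.
  + exact: eb.
  + by rewrite edge_sym; exact: eb.
  + rewrite indB //; apply/esym/negbTE.
    by rewrite /edge /= /copies_edge (ord1 i0) (ord1 j0) edge_irr andbF.
Qed.

Lemma card_nonneighbours_lt (G : sgraph) (l : nat) (S : {set G}) (v s : G) :
  free (P2_lP1 l) G -> independent S -> s \in S -> edge v s ->
  #|[set t in S | ~~ edge v t]| < l.
Proof.
move=> Gfree /independentP indS sS vs; rewrite ltnNge; apply/negP=> le_l.
apply: (not_free_P2_lP1 vs _ le_l) Gfree.
- apply/independentP=> x y; rewrite !inE => /andP[xS _] /andP[yS _].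
  exact: indS.
- by move=> x; rewrite inE => /andP[].
- by move=> x; rewrite inE => /andP[xS _]; rewrite indS.
Qed.

Lemma maximal_independent_neighbour (G : sgraph) (S : {set G}) (v : G) :
  maxset (@independent G) S -> v \notin S -> exists2 s, s \in S & edge v s.
Proof.
case/maxsetP=> /independentP indS maxS vS.
have [/exists_inP//|/exists_inPn noedge] := boolP [exists s in S, edge v s].
case/negP: (vS); rewrite -(maxS (v |: S)) ?setU11 ?subsetUr //.
apply/independentP=> x y; rewrite !inE.
case/predU1P=> [->|xS] /predU1P[->|yS].
- exact: edge_irr.
- exact/negbTE/noedge.
- by rewrite edge_sym; apply/negbTE/noedge.
- exact: indS.
Qed.

Lemma card_maximal_independent (G : sgraph) (k l : nat) (S : {set G}) :
  vertex_critical k G -> free (P2_lP1 l) G -> maxset (@independent G) S ->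
  #|S| <= (k.-1 * l.-1).+1.
Proof.
move=> [chiG crit] Gfree maxS; have indS := maxsetp maxS.
have /independentP edgeS := indS.
have [->|/set0Pn[s sS]] := eqVneq S set0; first by rewrite cards0.
have k_gt0 : 0 < k by exact: leq_ltn_trans (crit s).
have : colorable (del_vertex s) k.-1 by rewrite colorableE -ltnS prednK.
case/induced_colorable_proper=> c [c_lt c_edge].
rewrite (cardsD1 s S) sS ltnS; apply: (@card_le_classes _ _ c).
  by move=> x; rewrite !inE => /andP[xs _]; rewrite c_lt ?inE.
move=> i i_lt; rewrite leqNgt; apply/negP=> many_i.
have le_l : l <= #|[set x in S :\ s | c x == i]|.
  exact: leq_trans (leqSpred l) many_i.
(* A vertex of colour [i] misses at least [l] vertices of [S], so it lies in
   [S] and is not adjacent to [s]: this is why [s] can receive colour [i]. *)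
have iS x : x != s -> c x = i -> x \in S.
  move=> xs cx; apply: contraT => xS.
  have [t tS xt] := maximal_independent_neighbour maxS xS.
  have := card_nonneighbours_lt Gfree indS tS xt; rewrite ltnNge => /negP[].
  apply: leq_trans le_l _; apply/subset_leq_card/subsetP=> y; rewrite !inE.
  case/andP=> /andP[ys ->] /eqP cy /=; apply/negP=> xy.
  by have := c_edge x y; rewrite !inE cx cy eqxx => /(_ xs ys xy).
suff : colorable G k.-1 by rewrite colorableE chiG leqNgt ltn_predL k_gt0.
apply/colorable_proper; exists (fun x => if x == s then i else c x).
split=> [x _|x y _ _].
  by case: eqVneq => // xs; rewrite c_lt ?inE.
have [->|xs] := eqVneq x s; have [->|ys] := eqVneq y s.
- by rewrite edge_irr.
- by move=> sy; apply/eqP=> /esym/(iS _ ys) yS; rewrite edgeS in sy.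
- by move=> xs'; apply/eqP=> /(iS _ xs) xS; rewrite edgeS in xs'.
- by apply: c_edge; rewrite inE in_set1.
Qed.

Lemma card_critical_free (G : sgraph) (k l : nat) :
  vertex_critical k G -> free (P2_lP1 l) G -> #|G| <= k * (k.-1 * l.-1).+1.
Proof.
move=> Gcrit Gfree; have [chiG _] := Gcrit.
have : colorable G k by rewrite colorableE chiG.
case/colorable_proper=> c [c_lt c_edge].
rewrite -cardsT; apply: (card_le_classes c_lt) => i _.
have ind_i : independent [set x in [set: G] | c x == i].
  apply/independentP=> x y; rewrite !inE => /eqP cx /eqP cy.
  by apply/negP=> /c_edge; rewrite !inE cx cy eqxx => /(_ isT isT).
have [S maxS subS] := maxset_exists ind_i.
exact: leq_trans (subset_leq_card subS) (card_maximal_independent _ _ maxS).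
Qed.

Theorem theorem2p1 (k l : nat) (hk : 1 <= k) (hl : 1 <= l) :
  finite_up_to_iso (fun G : sgraph =>
    [/\ 0 < #|G|, vertex_critical k G & free (P2_lP1 l) G]).
Proof.
apply: (@finite_up_to_iso_bounded _ (k * (k.-1 * l.-1).+1)) => G [_].
exact: card_critical_free.
Qed.
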